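(* Let $X$ be an algebraic or compact Hamiltonian GKM space of complex dimension $m$ with GKM graph $(G,\alpha)$, let $\beta\in H_2(X;\mathbb{Z})$, $n\ge0$ and $\gamma_1,\dots,\gamma_n\in H_T^*(X)$. Consider the expression $$\sum_{\overrightarrow{\Gamma}\in\Gamma_n(X,\beta)}\frac{1}{|\mathrm{Aut}(\overrightarrow{\Gamma})|}\prod_{e\in E(\Gamma)}\frac{h(\overrightarrow{f}(e),\overrightarrow{d}(e))}{\overrightarrow{d}(e)}\prod_{v\in V(\Gamma)}\left(\alpha(\overrightarrow{f}(v))^{\mathrm{val}(v)-1}\prod_{i\in S_v}\gamma_i|_{\overrightarrow{f}(v)}\prod_{e\in E(\Gamma)_v}\alpha_{(e,v)}^{-1}\Big(\sum_{e\in E(\Gamma)_v}\alpha_{(e,v)}^{-1}\Big)^{n_v+\mathrm{val}(v)-3}\right)$$ (the localization formula for $GW_{0,n}^{X,\beta}(\gamma_1,\dots,\gamma_n)$), in which the factors $h$ are defined using a compatible connection $\nabla$ on $G$. This expression, and likewise its version for arbitrary genus, is independent of the choice of the compatible connection $\nabla$ on $G$.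
   Context: **GKM spaces.** An algebraic GKM space is a smooth quasi-projective complex variety $X$ with an algebraic action of $T=(\mathbb{C}^\times)^r$ such that $0<|X^T|<\infty$ and for each $p\in X^T$ the $T$-weights of $T_pX$ are pairwise linearly independent. A Hamiltonian GKM space is a connected symplectic manifold with compatible almost complex structure $J$ and a Hamiltonian action of $T=(S^1)^r$ preserving $J$, satisfying the same conditions on fixed points and weights. **GKM graph.** $V(G)=X^T$; the flags $F(G)$ are the pairs $(L,v)$, $v\in X^T$, $L$ a $T$-invariant irreducible (complex one-dimensional) summand of $T_vX$; an edge $e=\{p,q\}\in E(G)$ is a pair of distinct flags (denoted $(e,p)$, $(e,q)$) at fixed points $p,q$ tangent to a common $T$-stable $\mathbb{P}^1$ (or $S^2$) $C_e\ni p,q$. $F(G)_v$ is the set of flags at $v$ and $E(G)^\pm$ the set of flags belonging to edges. The axial function $\alpha:F(G)\to\mathfrak{t}^*$ sends $(L,v)$ to the $T$-weight of $L$; $\alpha(e,p)=-\alpha(e,q)$. **Compatible connection.** A collection of bijections $\nabla_{(e,p)}:F(G)_p\to F(G)_q$ for all $e=\{p,q\}\in E(G)$ such that $\nabla_{(e,q)}=\nabla_{(e,p)}^{-1}$ and, for every flag $\epsilon'\in F(G)_p$, there is $a\in\mathbb{Z}$ with $\alpha(\nabla_{(e,p)}\epsilon')=\alpha(\epsilon')-a\,\alpha(e,p)$. **Factors $h$.** For an edge $e$, one of its two flags $\epsilon\in F(G)_v$, and $d\ge1$, write $F(G)_v=\{\epsilon_1,\dots,\epsilon_{m-1},\epsilon\}$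 and let $a_i\in\mathbb{Z}$ be given by $\alpha(\nabla_\epsilon\epsilon_i)=\alpha(\epsilon_i)-a_i\alpha(\epsilon)$. Then $$h(e,d)=\frac{(-1)^dd^{2d}}{(d!)^2\alpha(\epsilon)^{2d}}\prod_{i=1}^{m-1}b\Big(\frac{\alpha(\epsilon)}{d},\alpha(\epsilon_i),da_i\Big),\qquad b(u,w,a)=\begin{cases}\prod_{j=0}^a(w-ju)^{-1}&a\ge0\\ \prod_{j=1}^{-a-1}(w+ju)&a<0\end{cases}$$ (this does not depend on which of the two flags of $e$ is used). **Decorated trees.** $\Gamma_n(X,\beta)$ is the set of (isomorphism classes of) decorated trees $\overrightarrow{\Gamma}$: a tree $\Gamma$, a graph map $\overrightarrow{f}:\Gamma\to G$ (sending vertices, edges, flags to vertices, edges, flags compatibly), a degree map $\overrightarrow{d}:E(\Gamma)\to\mathbb{Z}_{>0}$ with $\sum_{e}\overrightarrow{d}(e)[C_{\overrightarrow{f}(e)}]=\beta$, and a marking map $\overrightarrow{s}:\{1,\dots,n\}\to V(\Gamma)$. $\mathrm{Aut}(\overrightarrow{\Gamma})$ is the automorphism group of the decorated tree; $E(\Gamma)_v$ is the set of edges at $v$, $\mathrm{val}(v)=|E(\Gamma)_v|$; $S_v=\overrightarrow{s}^{-1}(v)$, $n_v=|S_v|$; $\alpha_{(e,v)}=\alpha(\overrightarrow{f}(e,v))/\overrightarrow{d}(e)$; for $v\in V(G)$, $\alpha(v)=\prod_{\epsilon\in F(G)_v}\alpha(\epsilon)$; $\gamma|_v$ denotes restriction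 to the fixed point $v$. **Arbitrary genus version** (Liu--Sheshmani). For genus $g$, trees are replaced by connected graphs $\Gamma$ with additional vertex genera $g_v\ge0$ such that $b_1(\Gamma)+\sum_vg_v=g$, and the vertex factor is replaced by $$\alpha(\overrightarrow{f}(v))^{\mathrm{val}(v)}\prod_{i\in S_v}\gamma_i|_{\overrightarrow{f}(v)}\int_{\overline{\mathcal{M}}_{g_v,E(\Gamma)_v\cup S_v}}\frac{\prod_{\epsilon\in F(G)_{\overrightarrow{f}(v)}}\Lambda^\vee_{g_v}(\alpha(\epsilon))/\alpha(\epsilon)}{\prod_{e\in E(\Gamma)_v}(\alpha_{(e,v)}-\psi_{(e,v)})},$$ where $\Lambda_g^\vee(u)=u^g-\lambda_1u^{g-1}+\dots+(-1)^g\lambda_g$, $\lambda_i$ are the Chern classes of the Hodge bundle and $\psi_{(e,v)}$ is the cotangent line class at the marked point $(e,v)$ (with the usual conventions for unstable $\overline{\mathcal{M}}_{0,1}$, $\overline{\mathcal{M}}_{0,2}$). The connection enters only via $h$. *)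

(* Defs.v *)
From HB Require Import structures.
From mathcomp Require Import all_boot all_order all_algebra.
From mathcomp Require Import perm mpoly.
From mathcomp Require Import boolp classical_sets functions cardinality fsbigop.
From mathcomp Require Import reals.

Set Implicit Arguments.
Unset Strict Implicit.
Unset Printing Implicit Defensive.

Import Order.TTheory GRing.Theory Num.Theory.
Local Open Scope ring_scope.
Local Open Scope quotient_scope.

(* [opp] exchanges the two flags of each edge and fixes the flags that belong
   to no edge; an edge is the pair of its flags, so multiple edges are allowed. *)
Definition edge (F : finType) (opp : F -> F) : Type :=
  {e : {set F} | [exists x, (opp x != x) && (e == [set x; opp x])]}.

(* H_T^*(pt; Q) = Q[t_1, ..., t_r] and its field of fractions; [lform] sends a
   weight in the character lattice Z^r to the corresponding linear form. *)
Definition HTpt (r : nat) := {mpoly rat[r]}.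
Definition HTfrac (r : nat) := {fraction {mpoly rat[r]}}.
Definition lform (r : nat) (w : 'rV[int]_r) : {mpoly rat[r]} :=
  \sum_(i < r) (w 0 i)%:~R *: 'X_i.

(* The data of a GKM space of complex dimension m with an action of a torus of
   rank r that enter the localization formula: the GKM graph with its axial
   function, the homology classes [C_e], and restriction to fixed points in
   equivariant cohomology. The listed properties hold both for algebraic and
   for compact Hamiltonian GKM spaces. *)
Record gkm_space (r m : nat) := GKMSpace {
  gV : finType;
  gF : finType;
  base : gF -> gV;
  opp : gF -> gF;
  axial : gF -> 'rV[int]_r;
  H2 : zmodType;
  curve_class : edge opp -> H2;
  HT : algType (HTpt r);
  restr : gV -> {lrmorphism HT -> (HTpt r)^o};
  gV_neq0 : (0 < #|gV|)%N;
  card_flags : forall v : gV, #|[set x | base x == v]| = m;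
  opp_inv : involutive opp;
  base_opp : forall x, opp x != x -> base (opp x) != base x;
  axial_opp : forall x, opp x != x -> axial (opp x) = - axial x;
  axial_neq0 : forall x, axial x != 0;
  axial_indep : forall x y, base x = base y -> x != y ->
    forall a b : int, a *: axial x + b *: axial y = 0 -> a = 0 /\ b = 0;
  restr_edge : forall x, opp x != x -> forall c : HT,
    exists q : HTpt r,
      restr (base x) c - restr (base (opp x)) c = lform (axial x) * q :> HTpt r;
  (* symplectic area, or the degree of an ample line bundle *)
  area_gt0 : exists (R : realType) (area : {additive H2 -> R}),
    forall e, 0 < area (curve_class e) }.

Section Connection.
Variables (r m : nat) (X : gkm_space r m).
Implicit Types (x y : gF X) (v : gV X).

Definition gedge := edge (@opp r m X).

Definition eflag (e : gedge) : gF X := xchoose (existsP (valP e)).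

(* [nabla x] is only meaningful on the flags at [base x], for [x] a flag of an
   edge. *)
Definition compatible_connection (nabla : gF X -> gF X -> gF X) : Prop :=
  forall x, opp x != x -> forall y, base y = base x ->
  [/\ base (nabla x y) = base (opp x),
      nabla (opp x) (nabla x y) = y &
      exists a : int, axial (nabla x y) = axial y - a *: axial x].

Definition wt x : HTfrac r := FracField.tofrac (lform (axial x)).

Definition wt_prod v : HTfrac r := \prod_(x | base x == v) wt x.

(* The integer a determined by
   axial (nabla x y) = axial y - a * axial x. *)
Definition conn_coef (nabla : gF X -> gF X -> gF X) x y : int :=
  xget 0 [set a : int | axial (nabla x y) = axial y - a *: axial x]%classic.

Definition bfac (u w : HTfrac r) (a : int) : HTfrac r :=
  match a with
  | Posz n => \prod_(0 <= j < n.+1) (w - j%:R * u)^-1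
  | Negz n => (* a = - n.+1 *) \prod_(1 <= j < n.+1) (w + j%:R * u)
  end.

Definition hflag (nabla : gF X -> gF X -> gF X) x (d : nat) : HTfrac r :=
  (-1) ^+ d * d%:R ^+ (2 * d) / ((d`!)%:R ^+ 2 * wt x ^+ (2 * d)) *
  \prod_(y | (base y == base x) && (y != x))
     bfac (wt x / d%:R) (wt y) (d%:Z * conn_coef nabla x y).

Definition hfac nabla (e : gedge) (d : nat) : HTfrac r :=
  hflag nabla (eflag e) d.

End Connection.

Section DecoratedGraphs.
Variables (r m : nat) (X : gkm_space r m) (n : nat).

(* The edge e of the source graph has the two flags (e, false), (e, true);
   the orientation of edges given by the boolean is irrelevant, as isomorphisms
   may reverse it. The source graph has no loops by [fF_base], [fF_opp] and
   [base_opp]. Trees are decorated graphs with zero genus function. *)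
Definition flip (l : nat) (x : 'I_l * bool) : 'I_l * bool := (x.1, ~~ x.2).

Record dgraph := DGraph {
  nv : nat;
  ne : nat;
  ends : 'I_ne * bool -> 'I_nv;
  fV : 'I_nv -> gV X;
  fE : 'I_ne -> gedge X;
  fF : 'I_ne * bool -> gF X;
  deg : 'I_ne -> nat;
  mark : 'I_n -> 'I_nv;
  gen : 'I_nv -> nat;
  fF_base : forall x, base (fF x) = fV (ends x);
  fF_opp : forall x, fF (flip x) = opp (fF x);
  fF_edge : forall x, fF x \in val (fE x.1);
  deg_gt0 : forall e, (0 < deg e)%N }.

HB.instance Definition _ := gen_eqMixin dgraph.
HB.instance Definition _ := gen_choiceMixin dgraph.

Definition dg_morph (D D' : dgraph) (sV : 'I_(nv D) -> 'I_(nv D'))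
    (sF : 'I_(ne D) * bool -> 'I_(ne D') * bool) : Prop :=
  [/\ forall x, sF (flip x) = flip (sF x) &
      forall x, ends (sF x) = sV (ends x)] /\
  [/\ forall v, fV (sV v) = fV v,
      forall x, fE (sF x).1 = fE x.1,
      forall x, fF (sF x) = fF x &
      forall x, deg (sF x).1 = deg x.1] /\
  [/\ forall i, mark D' i = sV (mark D i) &
      forall v, gen (sV v) = gen v].

Definition dg_iso (D D' : dgraph) : Prop :=
  exists sV, exists sF, [/\ bijective sV, bijective sF & @dg_morph D D' sV sF].

Definition dg_isob (D D' : dgraph) : bool := `[< dg_iso D D' >].

Lemma dg_isob_refl : reflexive dg_isob.
Proof.
move=> D; apply/asboolP; exists id, id; split; first by exists id.
  by exists id.
by [].
Qed.

Lemma dg_iso_sym D D' : dg_iso D D' -> dg_iso D' D.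
Proof.
case=> sV [sF [[tV sVK tVK] [tF sFK tFK]]].
case=> -[hflip hends] [[hV hE hF hd] [hm hg]].
exists tV, tF; split; [by exists sV | by exists sF |].
split; [split|split; split] => x.
- by apply: (can_inj sFK); rewrite tFK hflip tFK.
- by apply: (can_inj sVK); rewrite tVK -hends tFK.
- by rewrite -hV tVK.
- by rewrite -hE tFK.
- by rewrite -hF tFK.
- by rewrite -hd tFK.
- by apply: (can_inj sVK); rewrite tVK -hm.
- by rewrite -hg tVK.
Qed.

Lemma dg_isob_sym : ssrbool.symmetric dg_isob.
Proof. by move=> D D'; apply/asboolP/asboolP; apply: dg_iso_sym. Qed.

Lemma dg_isob_trans : transitive dg_isob.
Proof.
move=> D' D D'' /asboolP[sV [sF [bV bF [[h1 h2] [[h3 h4 h5 h6] [h7 h8]]]]]].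
move=> /asboolP[tV [tF [cV cF [[k1 k2] [[k3 k4 k5 k6] [k7 k8]]]]]].
apply/asboolP; exists (tV \o sV), (tF \o sF).
split; [exact: bij_comp | exact: bij_comp |].
split; [split|split; split] => x /=.
- by rewrite h1 k1.
- by rewrite k2 h2.
- by rewrite k3 h3.
- by rewrite k4 h4.
- by rewrite k5 h5.
- by rewrite k6 h6.
- by rewrite k7 h7.
- by rewrite k8 h8.
Qed.

Canonical dg_iso_equiv :=
  EquivRel dg_isob dg_isob_refl dg_isob_sym dg_isob_trans.

Definition dg_class := {eq_quot dg_isob}.
HB.instance Definition _ := Choice.on dg_class.
HB.instance Definition _ := EqQuotient.on dg_class.

Section OneGraph.
Variable D : dgraph.

Definition dg_aut : {set {perm 'I_(nv D)} * {perm 'I_(ne D) * bool}} :=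
  [set s : {perm 'I_(nv D)} * {perm 'I_(ne D) * bool}
    | `[< @dg_morph D D s.1 s.2 >]].

(* E(Gamma)_v, an edge at v being represented by its flag at v. *)
Definition flags_at (v : 'I_(nv D)) : {set 'I_(ne D) * bool} :=
  [set x | ends x == v].
Definition marks_at (v : 'I_(nv D)) : {set 'I_n} := [set i | mark D i == v].
Definition vval (v : 'I_(nv D)) : nat := #|flags_at v|.
Definition vmrk (v : 'I_(nv D)) : nat := #|marks_at v|.

Definition dg_adj : rel 'I_(nv D) :=
  fun u v => [exists x, (@ends D x == u) && (ends (flip x) == v)].
Definition dg_connected : bool :=
  (0 < nv D)%N && [forall u, forall v, connect dg_adj u v].

(* The oriented edges of a closed trail are recorded by their initial flags. *)
Definition dg_acyclic : Prop :=
  forall c : seq ('I_(ne D) * bool), uniq [seq x.1 | x <- c] ->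
    cycle (fun x y => @ends D (flip x) == ends y) c -> c = [::].
Definition dg_tree : Prop := dg_connected /\ dg_acyclic.

(* b_1 = dim H_1 = dim of the kernel of the boundary map Q^E -> Q^V. *)
Definition dg_boundary : 'M[rat]_(ne D, nv D) :=
  \matrix_(e, v) ((@ends D (e, true) == v)%:R - (@ends D (e, false) == v)%:R).
Definition dg_b1 : nat := \rank (kermx dg_boundary).

Definition dg_degree : H2 X := \sum_(e < ne D) curve_class (fE e) *+ deg e.

End OneGraph.

Definition decorated_trees (beta : H2 X) : set dg_class :=
  [set c | exists D : dgraph, [/\ c = \pi_dg_class D, dg_tree D,
     forall v, @gen D v = 0%N & dg_degree D = beta]]%classic.

Definition decorated_graphs (g : nat) (beta : H2 X) : set dg_class :=
  [set c | exists D : dgraph, [/\ c = \pi_dg_class D, dg_connected D,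
     (dg_b1 D + \sum_(v < nv D) @gen D v)%N = g & dg_degree D = beta]]%classic.

End DecoratedGraphs.
Arguments decorated_trees {r m X} n beta.
Arguments decorated_graphs {r m X} n g beta.

(* The K-algebras H^{2*}(Mbar_{g,S}; K) with the Chern classes of the Hodge
   bundle, the cotangent line classes and integration, given abstractly by a
   list of their properties; only stable (g, S) are meaningful. *)
Definition stable (g : nat) (S : finType) : bool := (2 < 2 * g + #|S|)%N.

Record moduli_cohomology (K : fieldType) := ModuliCohomology {
  coh : nat -> finType -> comUnitAlgType K;
  lambda : forall g (S : finType), nat -> coh g S;
  psi : forall g (S : finType), S -> coh g S;
  integral : forall g (S : finType), {scalar coh g S};
  lambda0 : forall g (S : finType), stable g S -> lambda g S 0 = 1;
  lambda_gt : forall g (S : finType) i, stable g S -> (g < i)%N -> lambda g S i = 0;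
  psi_nilp : forall g (S : finType) s, stable g S ->
    @psi g S s ^+ (3 * g + #|S|).-2 = 0;
  integral_dim : forall g (S : finType) (p : nat -> nat) (q : S -> nat), stable g S ->
    (\sum_(1 <= i < g.+1) i * p i + \sum_s q s + 3 != 3 * g + #|S|)%N ->
    integral g S (\prod_(1 <= i < g.+1) lambda g S i ^+ p i *
                  \prod_s psi g s ^+ q s) = 0;
  relabel : forall g (S S' : finType) (phi : S -> S'), stable g S ->
    bijective phi -> exists F : {lrmorphism coh g S -> coh g S'},
      [/\ forall i, F (lambda g S i) = lambda g S' i,
          forall s, F (psi g s) = psi g (phi s) &
          forall c, integral g S' (F c) = integral g S c] }.

Definition Lambda_dual (K : fieldType) (M : moduli_cohomology K) (g : nat)
    (S : finType) (u : K) : coh M g S :=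
  \sum_(0 <= i < g.+1) ((-1) ^+ i * u ^+ (g - i)) *: lambda M g S i.

Section Localization.
Variables (r m : nat) (X : gkm_space r m) (n : nat).
Variables (gamma : 'I_n -> HT X) (nabla : gF X -> gF X -> gF X).

Definition edge_factor (D : dgraph X n) : HTfrac r :=
  \prod_(e < ne D) (hfac nabla (fE e) (deg e) / (deg e)%:R).

Definition alpha_flag (D : dgraph X n) (x : 'I_(ne D) * bool) : HTfrac r :=
  wt (fF x) / (deg x.1)%:R.

Definition insertion (D : dgraph X n) (v : 'I_(nv D)) : HTfrac r :=
  \prod_(i in marks_at v)
     FracField.tofrac (restr (fV v) (gamma i) : {mpoly rat[r]}).

Definition tree_vertex_factor (D : dgraph X n) (v : 'I_(nv D)) : HTfrac r :=
  wt_prod (fV v) ^ ((vval v)%:Z - 1) * insertion v *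
  (\prod_(x in flags_at v) (alpha_flag x)^-1) *
  (\sum_(x in flags_at v) (alpha_flag x)^-1)
    ^ ((vmrk v)%:Z + (vval v)%:Z - 3).

Definition tree_contribution (D : dgraph X n) : HTfrac r :=
  (#|dg_aut D|)%:R^-1 * edge_factor D *
  \prod_(v < nv D) tree_vertex_factor v.

(* Only finitely many classes occur, by [area_gt0]: the number of edges and the
   degrees are bounded, and a connected graph has at most ne + 1 vertices. *)
Definition GW0 (beta : H2 X) : HTfrac r :=
  \sum_(c \in decorated_trees n beta) tree_contribution (repr c).

Variable M : moduli_cohomology (HTfrac r).

(* The finite set E(Gamma)_v + S_v labelling the marked points. *)
Definition points_at (D : dgraph X n) (v : 'I_(nv D)) : finType :=
  ({x | x \in flags_at v} + {i | i \in marks_at v})%type.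

Definition hodge_integrand (D : dgraph X n) (v : 'I_(nv D))
    : coh M (gen v) (points_at v) :=
  (\prod_(y | base y == fV v)
     ((wt y)^-1 *: Lambda_dual M (gen v) (points_at v) (wt y))) /
  (\prod_(x : {x | x \in flags_at v})
     ((alpha_flag (val x))%:A - psi M (gen v) (inl x : points_at v))).

(* The conventions for Mbar_{0,1} and Mbar_{0,2}: the integrals of
   1 / (a - psi), 1 / (a - psi_1) and 1 / ((a - psi_1) (b - psi_2)) are
   a, 1 and 1 / (a + b); Lambda_0^dual = 1. The remaining unstable cases
   (no edge at v) do not contribute. *)
Definition unstable_integral (D : dgraph X n) (v : 'I_(nv D)) : HTfrac r :=
  (wt_prod (fV v))^-1 *
  match vval v, vmrk v with
  | 1, 0 => \sum_(x in flags_at v) alpha_flag x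
  | 1, 1 => 1
  | 2, 0 => (\sum_(x in flags_at v) alpha_flag x)^-1
  | _, _ => 0
  end.

Definition vertex_integral (D : dgraph X n) (v : 'I_(nv D)) : HTfrac r :=
  if stable (gen v) (points_at v)
  then integral M (gen v) (points_at v) (hodge_integrand v)
  else unstable_integral v.

Definition graph_contribution (D : dgraph X n) : HTfrac r :=
  (#|dg_aut D|)%:R^-1 * edge_factor D *
  \prod_(v < nv D)
    (wt_prod (fV v) ^+ vval v * insertion v * vertex_integral v).

Definition GWg (g : nat) (beta : H2 X) : HTfrac r :=
  \sum_(c \in decorated_graphs n g beta) graph_contribution (repr c).

End Localization.

(* Main.v *)
From mathcomp Require Import all_boot all_order all_algebra.
From mathcomp Require Import ring mpoly classical_sets fsbigop.
Require Import Defs.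

(** The connection enters the localization formula only through the factors
    h(e, d), and each single factor is already independent of it.  Fix a flag
    x of the edge e from p to q, put u = alpha(x) and s = u / d, and let y be
    another flag at p, carried by the connection to z, so that
    alpha(z) = alpha(y) - a u.  The factor b(s, alpha(y), d a) is the inverse
    of the product of all terms of the arithmetic progression of step s that
    descends from alpha(y) to alpha(z), both ends included; for negative a it
    is the analytic continuation of this in the sense of Gamma functions.
    Hence, just as a quotient of Gamma functions, it splits as Phi(y) / Psi(z)
    with Phi and Psi depending on one end only: one cuts the progression at a
    base point that depends only on the class of the weight modulo Z u
    ([bfac_split]).  Taking the product over y, the map y |-> z runs through
    all flags at q other than the one of e, so that the product equals
    prod_y Phi(y) / prod_z Psi(z), in which no connection is left
    ([prod_bfac]).

    The cut is legitimate because none of the linear forms occurring vanishes: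
    the weights at p are pairwise linearly independent.  The same hypothesis
    at q forces a compatible connection to send x to the opposite flag of e
    ([nabla_self]), hence to match the remaining flags at p with the remaining
    ones at q. *)

Set Implicit Arguments.
Unset Strict Implicit.
Unset Printing Implicit Defensive.

Import Order.TTheory GRing.Theory Num.Theory.
Local Open Scope ring_scope.

(** * Weights and their linear forms *)

Section Weights.
Variable r : nat.
Implicit Types (u v w : 'rV[int]_r).

Lemma lformB v w : lform (v - w) = lform v - lform w.
Proof.
rewrite /lform -sumrB; apply: eq_bigr => i _.
by rewrite !mxE rmorphB scalerBl.
Qed.

Lemma lformZ (a : int) w : lform (a *: w) = a%:~R * lform w.
Proof.
rewrite /lform mulr_sumr; apply: eq_bigr => i _.
by rewrite !mxE intrM -scalerA scaler_int -mulrzl.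
Qed.

Lemma lform_inj0 w : lform w = 0 -> w = 0.
Proof.
move=> w0; apply/rowP => i; rewrite mxE.
have /eqP := congr1 (mcoeff U_(i)) w0.
rewrite mcoeff0 /lform raddf_sum /= (bigD1 i) //= big1 => [|j ji].
  by rewrite mcoeffZ mcoeffXU eqxx mulr1 addr0 intr_eq0 => /eqP.
by rewrite mcoeffZ mcoeffXU (negPf ji) mulr0.
Qed.

Definition lfrac w : HTfrac r := FracField.tofrac (lform w).

Lemma lfracB v w : lfrac (v - w) = lfrac v - lfrac w.
Proof. by rewrite /lfrac lformB rmorphB. Qed.

Lemma lfracZ (a : int) w : lfrac (a *: w) = a%:~R * lfrac w.
Proof. by rewrite /lfrac lformZ rmorphM /= rmorph_int. Qed.

Lemma lfrac_eq0 w : (lfrac w == 0) = (w == 0).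
Proof.
rewrite /lfrac tofrac_eq0; apply/eqP/eqP => [/lform_inj0 //|->].
by rewrite /lform big1 // => i _; rewrite mxE scale0r.
Qed.

Lemma HTfrac_natr_neq0 (d : nat) : (0 < d)%N -> d%:R != 0 :> HTfrac r.
Proof.
move=> d0; rewrite -(rmorph_nat (@FracField.tofrac _)) tofrac_eq0.
by rewrite -mpolyC_nat mpolyC_eq0 pnatr_eq0 -lt0n.
Qed.

(** An integer that drops by a when a u is subtracted from a weight: the
    number of steps u from a weight down to a base point of its class modulo
    Z u. Any nonzero coordinate of u provides one, by Euclidean division. *)
Definition height u w : int :=
  if [pick i | u 0 i != 0] is Some i then (w 0%R i %/ u 0%R i)%Z else 0.

Lemma heightB u w (a : int) : u != 0 ->
  height u (w - a *: u) = height u w - a.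
Proof.
rewrite /height; case: pickP => [i ui _|u0 /eqP[]]; last first.
  by apply/rowP => i; rewrite mxE; apply/eqP; have := u0 i; case: eqP.
by rewrite !mxE -mulNr addrC divzMDl // addrC.
Qed.

End Weights.

(** * The factors b along an arithmetic progression *)

Section Progression.
Variables (r : nat) (s : HTfrac r).
Implicit Types (w : HTfrac r) (a c k : int).

(** No term of the bi-infinite progression through w vanishes, so that inverses
    are genuine wherever the progression is cut. *)
Definition avoids0 w := forall k, w - k%:~R * s != 0.

Lemma avoids0_shift w a : avoids0 w -> avoids0 (w - a%:~R * s).
Proof. by move=> w0 k; rewrite -addrA -opprD -mulrDl -intrD. Qed.

Lemma bfacN1 w : bfac s w (- 1) = 1.
Proof. by rewrite [LHS]big_geq. Qed.

(** The two branches in the definition of b are one function of a: both obey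
    this recursion, across a = 0 too, and it determines b from [bfacN1]. *)
Lemma bfac_rec w a : avoids0 w ->
  bfac s w a = bfac s w (a - 1) / (w - a%:~R * s).
Proof.
move=> w0; case: a => [[|n]|n].
- by rewrite sub0r bfacN1 /bfac big_nat1 mul1r.
- have -> : n.+1%:Z - 1 = n by rewrite -addn1 PoszD addrK.
  by rewrite /bfac big_nat_recr.
- have -> : Negz n - 1 = Negz n.+1 by rewrite !NegzE -opprD -PoszD addn1.
  rewrite /bfac [in RHS]big_nat_recr //= NegzE rmorphN mulNr opprK.
  rewrite mulfK //; have := w0 (Negz n).
  by rewrite NegzE rmorphN mulNr opprK.
Qed.

(** Cutting a progression of a + c + 1 terms after its first a + 1 terms. As
    functions of c, both sides obey the recursion [bfac_rec] with the same
    denominators, and they agree at c = 0. *)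
Lemma bfac_cat w a c : avoids0 w ->
  bfac s w (a + c) = bfac s w a * bfac s (w - (a + 1)%:~R * s) (c - 1).
Proof.
move=> w0.
have w1 := avoids0_shift (a + 1) w0.
have rec k : bfac s w (a + k) = bfac s w (a + (k - 1)) / (w - (a + k)%:~R * s).
  by rewrite bfac_rec // addrA.
have rec1 k : bfac s (w - (a + 1)%:~R * s) (k - 1) =
    bfac s (w - (a + 1)%:~R * s) (k - 1 - 1) / (w - (a + k)%:~R * s).
  rewrite bfac_rec //; congr (_ / _).
  by rewrite -addrA -opprD -mulrDl -intrD; congr (_ - _%:~R * _); ring.
elim/int_rect: c => [|k IH|k IH].
- by rewrite addr0 sub0r bfacN1 mulr1.
- have e : k.+1%:Z - 1 = k by rewrite -addn1 PoszD addrK.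
  by rewrite rec rec1 e IH mulrA.
- have e : - k%:Z - 1 = - k.+1%:Z by rewrite -opprD -PoszD addn1.
  move: IH; rewrite rec rec1 e mulrA => /mulIf; apply.
  by rewrite invr_eq0; apply: w0.
Qed.

Lemma bfac_neq0 w a : avoids0 w -> bfac s w a != 0.
Proof.
move=> w0; case: a => n; rewrite /bfac prodf_seq_neq0; apply/allP => j _ /=.
  by rewrite invr_neq0 ?(w0 j).
by have := w0 (- j%:Z); rewrite rmorphN mulNr opprK.
Qed.

(** The base point of the cut is w - n s. The numerator runs from w down to the
    term just above it; the denominator runs from the term that follows the
    last one, w - a s, down to the same place. Hence each of them depends on
    one end and on the number of steps, n or n - a, from that end down to the
    base point. *)
Lemma bfac_split w a n : avoids0 w ->
  bfac s w a =
  bfac s w (n - 1) / bfac s (w - a%:~R * s - s) (n - a - 2).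
Proof.
move=> w0.
have -> : w - a%:~R * s - s = w - (a + 1)%:~R * s.
  by rewrite intrD mulrDl mul1r opprD addrA.
have -> : n - 1 = a + (n - a - 1) by ring.
have -> : n - a - 2 = n - a - 1 - 1 by ring.
rewrite (bfac_cat _ _ w0) mulfK; first by [].
exact/bfac_neq0/avoids0_shift.
Qed.

End Progression.

(** * Independence of the edge factors *)

Section EdgeFactor.
Variables (r m : nat) (X : gkm_space r m).
Implicit Types (x y : gF X).

Lemma wtE x : wt x = lfrac (axial x). Proof. by []. Qed.

Lemma int_mul_divn (d : nat) (a : int) (u : HTfrac r) : (0 < d)%N ->
  (d%:Z * a)%:~R * (u / d%:R) = a%:~R * u.
Proof.
by move=> d0; rewrite intrM mulrC mulrA divfK ?(HTfrac_natr_neq0 r d0) // mulrC.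
Qed.

Lemma avoids0_wt x y d : (0 < d)%N -> base y = base x -> y != x ->
  avoids0 (wt x / d%:R) (wt y).
Proof.
move=> d0 yx neq k; apply/eqP => e.
have : d%:Z *: axial y + (- k) *: axial x = 0.
  apply/eqP; rewrite scaleNr -lfrac_eq0 lfracB !lfracZ -!wtE subr_eq0.
  move/eqP: e; rewrite subr_eq0 => /eqP->.
  by rewrite mulrA -intrM int_mul_divn.
by case/(axial_indep yx neq) => d00; case: d d0 d00 {e}.
Qed.

Section Connection.
Variables (nabla : gF X -> gF X -> gF X).
Hypothesis nablaP : compatible_connection nabla.

Lemma axial_nabla x y : opp x != x -> base y = base x ->
  axial (nabla x y) = axial y - conn_coef nabla x y *: axial x.
Proof.
move=> ex yx; have [_ _ [a ha]] := nablaP ex yx.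
by rewrite /conn_coef; case: xgetP => [c _ //|/(_ a)].
Qed.

(** The weight of nabla x x is a multiple of axial x, hence of the weight of
    opp x, and distinct flags at one vertex have independent weights. *)
Lemma nabla_self x : opp x != x -> nabla x x = opp x.
Proof.
move=> ex; have [bx _ _] := nablaP ex (erefl (base x)).
apply/eqP/negP => /negP neq.
have := axial_nabla ex (erefl (base x)); move: (conn_coef _ _ _) => a h.
have /(axial_indep bx neq)[] //:
  1 *: axial (nabla x x) + (1 - a) *: axial (opp x) = 0.
by rewrite h axial_opp // scalerN scalerBl !scale1r subrr.
Qed.

Lemma opp_edge x : opp x != x -> opp (opp x) != opp x.
Proof. by rewrite opp_inv eq_sym. Qed.

Lemma nabla_other x y : opp x != x -> base y = base x ->
  (base (nabla x y) = base (opp x)) * ((nabla x y == opp x) = (y == x)).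
Proof.
move=> ex yx; have [bz yK _] := nablaP ex yx; split=> //.
apply/eqP/eqP => [e|->]; last exact: nabla_self.
by rewrite -yK e nabla_self ?opp_inv // eq_sym.
Qed.

(** Each factor is split at a base point found from the height of either end,
    and the connection, being a bijection between the flags at the two ends of
    the edge that keeps the edge itself, reindexes the denominators. *)
Lemma prod_bfac x d : opp x != x -> (0 < d)%N ->
  \prod_(y | (base y == base x) && (y != x))
     bfac (wt x / d%:R) (wt y) (d%:Z * conn_coef nabla x y) =
  (\prod_(y | (base y == base x) && (y != x))
     bfac (wt x / d%:R) (wt y) (d%:Z * height (axial x) (axial y) - 1)) /
  \prod_(z | (base z == base (opp x)) && (z != opp x))
     bfac (wt x / d%:R) (wt z - wt x / d%:R)
          (d%:Z * height (axial x) (axial z) - 2).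
Proof.
move=> ex d0.
rewrite [X in _ = _ / X](reindex_onto (nabla x) (nabla (opp x))) /=; last first.
  move=> z /andP[/eqP bz _]; have [_ + _] := nablaP (opp_edge ex) bz.
  by rewrite opp_inv.
have sameP y : ((base (nabla x y) == base (opp x)) && (nabla x y != opp x)) &&
   (nabla (opp x) (nabla x y) == y) = (base y == base x) && (y != x).
  apply/idP/idP => [/andP[/andP[/eqP bz nz] /eqP yK]|/andP[/eqP yx nyx]].
    have yx : base y = base x.
      have [+ _ _] := nablaP (opp_edge ex) bz; by rewrite yK opp_inv.
    by rewrite yx eqxx /= -(nabla_other ex yx).2.
  by have [_ -> _] := nablaP ex yx; rewrite !(nabla_other ex yx) !eqxx nyx.
rewrite [X in _ = _ / X](eq_bigl _ _ sameP) -prodf_div.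
apply: eq_bigr => y /andP[/eqP yx nyx].
rewrite (bfac_split _ (d%:Z * height (axial x) (axial y))) //; last first.
  exact: avoids0_wt.
rewrite !wtE axial_nabla // heightB ?axial_neq0 // lfracB lfracZ.
by rewrite int_mul_divn // mulrBr.
Qed.

End Connection.

Lemma hflag_indep (nabla nabla' : gF X -> gF X -> gF X) x d :
  compatible_connection nabla -> compatible_connection nabla' ->
  opp x != x -> (0 < d)%N -> hflag nabla x d = hflag nabla' x d.
Proof. by move=> h h' ex d0; rewrite /hflag !prod_bfac. Qed.

Lemma eflag_edge (e : gedge X) : opp (eflag e) != eflag e.
Proof. by rewrite /eflag; case/andP: (xchooseP (existsP (valP e))). Qed.

Lemma edge_factor_indep n (nabla nabla' : gF X -> gF X -> gF X)
    (D : dgraph X n) :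
  compatible_connection nabla -> compatible_connection nabla' ->
  edge_factor nabla D = edge_factor nabla' D.
Proof.
move=> h h'; apply: eq_bigr => e _; congr (_ / _).
exact: hflag_indep h h' (eflag_edge _) (deg_gt0 _).
Qed.

End EdgeFactor.

Theorem theorem3p6 (r m : nat) (X : gkm_space r m) (beta : H2 X) (n : nat)
    (gamma : 'I_n -> HT X) (M : moduli_cohomology (HTfrac r))
    (nabla nabla' : gF X -> gF X -> gF X) :
  compatible_connection nabla -> compatible_connection nabla' ->
  GW0 gamma nabla beta = GW0 gamma nabla' beta /\
  (forall g : nat, GWg gamma nabla M g beta = GWg gamma nabla' M g beta).
Proof.
move=> h h'; split=> [|g]; apply: eq_fsbigr => c _.
  by rewrite /tree_contribution (edge_factor_indep _ h h').
by rewrite /graph_contribution (edge_factor_indep _ h h').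
Qed.
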